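(* Let $B$ be a densely defined closed symmetric completely non-selfadjoint operator on a Hilbert space $\mathcal{H}$ with finite deficiency indices $(n,n)$, let $\Pi=(\mathbb{C}^n,\Gamma_1,\Gamma_2)$ be a boundary triplet for $B^*$ with Weyl function $M$. Let $D,D'\in\mathbb{H}_n$ with $\det(D-D')\neq0$. For $E\in\mathbb{H}_n$ let $A_E$ be the self-adjoint extension of $B$ with domain $\operatorname{Ker}(\Gamma_2-E\Gamma_1)$. Let $M_{D'}(z):=[D'-M(z)]^{-1}$ be the Weyl function of $A_{D'}$ and $\Omega_{D'}$ the matrix-valued measure associated with $M_{D'}$. Then $$\sigma_p^{max}(A_D)=\Big\{x\in\mathbb{R}:\int_{\mathbb{R}}\frac{d\Omega_{D'}(y)}{(x-y)^2}\in\mathbb{C}^{n\times n}\ \text{and}\ M_{D'}(x+i0)=(D'-D)^{-1}\Big\},$$ where $M_{D'}(x+i0):=\lim_{\varepsilon\to0^+}M_{D'}(x+i\varepsilon)$ (the condition including existence of this limit).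
   Context: A boundary triplet for $B^*$ is $(\mathbb{C}^n,\Gamma_1,\Gamma_2)$ with linear $\Gamma_i:D(B^* )\to\mathbb{C}^n$ satisfying $\langle B^*x,y\rangle-\langle x,B^*y\rangle=\langle\Gamma_2x,\Gamma_1y\rangle-\langle\Gamma_1x,\Gamma_2y\rangle$ for $x,y\in D(B^* )$ and with $x\mapsto(\Gamma_1x,\Gamma_2x)$ surjective onto $\mathbb{C}^n\oplus\mathbb{C}^n$. $A_1$ is the restriction of $B^*$ to $\operatorname{Ker}\Gamma_1$. The Weyl function $M:\varrho(A_1)\to\mathbb{C}^{n\times n}$ is defined by $\Gamma_2f_z=M(z)\Gamma_1f_z$ for all $f_z\in\operatorname{Ker}(B^*-zI)$. $\mathbb{H}_n$ is the set of self-adjoint $n\times n$ complex matrices. Completely non-selfadjoint: no reducing subspace on which the part of $B$ is self-adjoint. $\sigma_p^{max}(A)$ is the set of eigenvalues $z$ of $A$ with $\dim\operatorname{Ker}(A-zI)=n$. The matrix-valued measure associated with a Nevanlinna–Herglotz matrix $F$ is the measure $\Omega$ (positive-semidefinite-matrix-valued on bounded Borel sets, countably additive) in the representation $F(z)=C+Kz+\int_{\mathbb{R}}\big(\frac{1}{y-z}-\frac{y}{1+y^2}\big)d\Omega(y)$ with $C=C^*$, $K\ge0$. For a Borel $f$, $\int f\,d\Omega\in\mathbb{C}^{n\times n}$ means the form $(a,b)\mapsto\int f(y)\,d\langle a,\Omega(y)b\rangle$ is finite for all $a,b\in\mathbb{C}^n$, the integral being the associated matrix. *)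

(* Defs.v *)
(* MathComp + MathComp-Analysis (+ mathcomp-real-closed complex numbers R[i]). *)
From mathcomp Require Import all_boot all_order all_algebra.
From mathcomp Require Import all_classical all_reals all_analysis.
From mathcomp Require Import complex.

Set Implicit Arguments.
Unset Strict Implicit.
Unset Printing Implicit Defensive.

Import Order.TTheory GRing.Theory Num.Theory.
Local Open Scope ring_scope.
Local Open Scope classical_set_scope.

(* Complex numbers C := R[i] over a realType R.                              *)
Section ComplexHelpers.
Variable R : realType.
Local Notation C := R[i].

Definition reC (z : C) : R := let: (a +i* _)%C := z in a.
Definition imC (z : C) : R := let: (_ +i* b)%C := z in b.
Definition toC (y : R) : C := (y +i* 0)%C.

(* convergence of a complex sequence *)
Definition cvgC (u : nat -> C) (l : C) :=
  forall e : C, 0 < e -> exists N, forall k, (N <= k)%N -> `|u k - l| < e.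
End ComplexHelpers.

(* Hilbert space and (unbounded) operators.                                  *)
(* A (partial) linear operator is a pair (dom : set H, T : H -> H).          *)
(* The inner product is linear in the first argument.                        *)
Section Hilbert.
Variables (R : realType) (H : lmodType R[i]) (ip : H -> H -> R[i]).
Local Notation C := R[i].

Definition is_inner_product :=
  [/\ (forall (a : C) x y z, ip (a *: x + y) z = a * ip x z + ip y z),
      (forall x y, ip y x = (ip x y)^*),
      (forall x, 0 <= ip x x) &
      (forall x, ip x x = 0 -> x = 0)].

(* norm convergence, phrased with the squared norm ip v v *)
Definition hcvg (u : nat -> H) (x : H) :=
  forall e : C, 0 < e -> exists N, forall k, (N <= k)%N ->
    ip (u k - x) (u k - x) < e.

Definition hcauchy (u : nat -> H) :=
  forall e : C, 0 < e -> exists N, forall k m, (N <= k)%N -> (N <= m)%N ->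
    ip (u k - u m) (u k - u m) < e.

Definition is_hilbert :=
  is_inner_product /\ forall u, hcauchy u -> exists x, hcvg u x.

Definition lin_subspace (L : set H) :=
  L 0 /\ forall (a : C) x y, L x -> L y -> L (a *: x + y).

Definition linear_on (D : set H) (T : H -> H) :=
  forall (a : C) x y, D x -> D y -> T (a *: x + y) = a *: T x + T y.

Definition operator (D : set H) (T : H -> H) := lin_subspace D /\ linear_on D T.

Definition dense_dom (D : set H) :=
  forall x (e : C), 0 < e -> exists2 d, D d & ip (x - d) (x - d) < e.

(* closed graph *)
Definition closed_op (D : set H) (T : H -> H) :=
  forall (u : nat -> H) x y, (forall k, D (u k)) -> hcvg u x ->
    hcvg (T \o u) y -> D x /\ T x = y.

Definition symmetric_op (D : set H) (T : H -> H) :=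
  forall x y, D x -> D y -> ip (T x) y = ip x (T y).

(* (Ds, Ts) is the adjoint of the densely defined operator (D, T) *)
Definition adjoint_of (D : set H) (T : H -> H) (Ds : set H) (Ts : H -> H) :=
  (forall y, Ds y <-> exists z, forall x, D x -> ip (T x) y = ip x z) /\
  (forall y x, Ds y -> D x -> ip (T x) y = ip x (Ts y)).

(* closed subspaces, orthogonal projections, reducing subspaces *)
Definition hclosed (L : set H) :=
  forall (u : nat -> H) x, (forall k, L (u k)) -> hcvg u x -> L x.

Definition is_proj (L : set H) (x l : H) :=
  L l /\ forall m, L m -> ip (x - l) m = 0.

(* L reduces T:  P D(T) ⊆ D(T) and P T x = T P x for x in D(T),
   P the orthogonal projection onto L *)
Definition reduces (L : set H) (D : set H) (T : H -> H) :=
  forall x l, D x -> is_proj L x l -> D l /\ is_proj L (T x) (T l).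

(* the part of T in L (domain D ∩ L) is a self-adjoint operator in L *)
Definition selfadjoint_part (L : set H) (D : set H) (T : H -> H) :=
  [/\ (forall x, D x -> L x -> L (T x)),
      (forall y (e : C), L y -> 0 < e ->
         exists2 d, D d /\ L d & ip (y - d) (y - d) < e),
      (forall x y, D x -> L x -> D y -> L y -> ip (T x) y = ip x (T y)) &
      (forall y, L y ->
         (exists2 z, L z & forall x, D x -> L x -> ip (T x) y = ip x z) ->
         D y)].

Definition completely_nonselfadjoint (D : set H) (T : H -> H) :=
  forall L, lin_subspace L -> hclosed L -> reduces L D T ->
    selfadjoint_part L D T -> forall x, L x -> x = 0.

(* finite dimension of a lin_subspace *)
Definition has_dim (K : set H) (n : nat) :=
  exists v : 'I_n -> H,
    [/\ (forall i, K (v i)),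
        (forall c : 'I_n -> C, \sum_i c i *: v i = 0 -> forall i, c i = 0) &
        (forall f, K f -> exists c : 'I_n -> C, f = \sum_i c i *: v i)].

(* Ker (T - z I) *)
Definition kerz (D : set H) (T : H -> H) (z : C) := [set f | D f /\ T f = z *: f].

(* deficiency indices (n, n) of B, given its adjoint (Ds, Ts) = B^* *)
Definition deficiency_indices (Ds : set H) (Ts : H -> H) (n : nat) :=
  has_dim (kerz Ds Ts 'i) n /\ has_dim (kerz Ds Ts (- 'i)) n.

(* resolvent set: T - z is a bijection of D onto H with bounded inverse *)
Definition in_resolvent (D : set H) (T : H -> H) (z : C) :=
  [/\ (forall g, exists f, D f /\ T f - z *: f = g),
      (forall f, D f -> T f - z *: f = 0 -> f = 0) &
      (exists c : C, forall f, D f ->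
         ip f f <= c * ip (T f - z *: f) (T f - z *: f))].

(* sigma_p^max : eigenvalues z with dim Ker (T - z) = n *)
Definition sigma_p_max (D : set H) (T : H -> H) (n : nat) (z : C) :=
  (exists2 f, kerz D T z f & f <> 0) /\ has_dim (kerz D T z) n.

(* standard inner product on C^n, linear in the first argument *)
Definition ipn n (u v : 'cV[C]_n) : C := \sum_i u i 0 * (v i 0)^*.

Definition boundary_triplet n (Ds : set H) (Ts : H -> H)
    (G1 G2 : H -> 'cV[C]_n) :=
  [/\ (forall (a : C) x y, Ds x -> Ds y -> G1 (a *: x + y) = a *: G1 x + G1 y),
      (forall (a : C) x y, Ds x -> Ds y -> G2 (a *: x + y) = a *: G2 x + G2 y),
      (forall x y, Ds x -> Ds y ->
         ip (Ts x) y - ip x (Ts y) = ipn (G2 x) (G1 y) - ipn (G1 x) (G2 y)) &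
      (forall u v, exists f, [/\ Ds f, G1 f = u & G2 f = v])].

(* domain of A_1 = B^* restricted to Ker Gamma_1 *)
Definition A1_dom n (Ds : set H) (G1 : H -> 'cV[C]_n) :=
  [set f | Ds f /\ G1 f = 0].

(* domain of A_E = B^* restricted to Ker (Gamma_2 - E Gamma_1) *)
Definition ext_dom n (Ds : set H) (G1 G2 : H -> 'cV[C]_n) (E : 'M[C]_n) :=
  [set f | Ds f /\ G2 f = E *m G1 f].

(* Weyl function, on rho(A_1) *)
Definition weyl_function n (Ds : set H) (Ts : H -> H)
    (G1 G2 : H -> 'cV[C]_n) (M : C -> 'M[C]_n) :=
  forall z, in_resolvent (A1_dom Ds G1) Ts z ->
    forall f, kerz Ds Ts z f -> G2 f = M z *m G1 f.

End Hilbert.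

(* Matrices, matrix-valued measures, Herglotz representation.                *)
Section MatrixMeasure.
Variable R : realType.
Local Notation C := R[i].

Definition hermitian_mx n (A : 'M[C]_n) := forall i j, A j i = (A i j)^*.

(* <A a, a> *)
Definition qform n (A : 'M[C]_n) (a : 'cV[C]_n) : C :=
  \sum_i \sum_j (a i 0)^* * A i j * a j 0.

Definition psd_mx n (A : 'M[C]_n) := hermitian_mx A /\ forall a, 0 <= qform A a.

Definition bounded_R (S : set R) := exists M : R, forall x, S x -> `|x| <= M.

(* mu is the scalar measure S |-> <Om(S) a, a> (on bounded Borel sets) *)
Definition scalar_part n (Om : set R -> 'M[C]_n) (a : 'cV[C]_n)
    (mu : {measure set R -> \bar R}) :=
  forall S, measurable S -> bounded_R S -> mu S = (reC (qform (Om S) a))%:E.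

(* a matrix-valued measure: psd_mx-valued on bounded Borel sets, countably
   additive there, with each scalar part extending to a Borel measure *)
Definition matrix_measure n (Om : set R -> 'M[C]_n) :=
  [/\ (forall S, measurable S -> bounded_R S -> psd_mx (Om S)),
      (forall F : nat -> set R, (forall k, measurable (F k)) ->
         trivIset setT F -> bounded_R (\bigcup_k F k) ->
         forall i j, cvgC (fun N => \sum_(k < N) Om (F k) i j)
                          (Om (\bigcup_k F k) i j)) &
      (forall a, exists mu, scalar_part Om a mu)].

(* integration of complex-valued functions against a positive measure *)
Definition cintegrable (mu : {measure set R -> \bar R}) (g : R -> C) :=
  mu.-integrable setT (fun y => (reC (g y))%:E) /\
  mu.-integrable setT (fun y => (imC (g y))%:E).

Definition cint (mu : {measure set R -> \bar R}) (g : R -> C) : C :=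
  (fine (\int[mu]_y (reC (g y))%:E)%E +i* fine (\int[mu]_y (imC (g y))%:E)%E)%C.

(* 1/(y - z) - y/(1 + y^2) *)
Definition herglotz_kernel (z : C) (y : R) : C :=
  (toC y - z)^-1 - toC (y / (1 + y ^+ 2)).

(* Om is the matrix-valued measure associated with the Nevanlinna-Herglotz
   function F:  F(z) = Cm + K z + \int (1/(y-z) - y/(1+y^2)) dOm(y),
   for all nonreal z; matrix identity tested on all quadratic forms <. a, a>,
   where by definition <(\int f dOm) a, a> = \int f d<Om a, a>. *)
Definition assoc_measure n (F : C -> 'M[C]_n) (Om : set R -> 'M[C]_n) :=
  matrix_measure Om /\
  exists Cm K : 'M[C]_n, [/\ hermitian_mx Cm, psd_mx K &
    forall a mu, scalar_part Om a mu -> forall z : C, imC z != 0 ->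
      cintegrable mu (herglotz_kernel z) /\
      qform (F z) a = qform Cm a + qform K a * z + cint mu (herglotz_kernel z)].

(* 1/(x - y)^2, equal to +oo at y = x *)
Definition inv_sq_kernel (x y : R) : \bar R :=
  if y == x then +oo%E else ((x - y) ^- 2)%:E.

(* \int dOm(y)/(x-y)^2 is a (finite) matrix: the form (a,b) |-> \int f d<Om a,b>
   is finite; for f >= 0 this is finiteness of all \int f d<Om a, a>. *)
Definition finite_inv_sq_integral n (Om : set R -> 'M[C]_n) (x : R) :=
  forall a mu, scalar_part Om a mu -> (\int[mu]_y inv_sq_kernel x y < +oo)%E.

(* F(x + i0) := lim_{eps -> 0+} F(x + i eps) exists and equals L *)
Definition boundary_value n (F : C -> 'M[C]_n) (x : R) (L : 'M[C]_n) :=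
  forall e : C, 0 < e -> exists2 d : R, 0 < d &
    forall eps : R, 0 < eps < d -> forall i j,
      `|F (x +i* eps)%C i j - L i j| < e.

End MatrixMeasure.

(* Main.v *)
(* Replacing (G1, G2) by (D' G1 - G2, G1) turns the Weyl function into
   N(z) = [D' - M(z)]^-1, the extension A_{D'} into the kernel of the first
   boundary map, and A_D into Ker(G2 - L G1) with L = (D' - D)^-1.  As B has no
   eigenvalues, the first boundary map is injective on Ker(A_D - x), so the
   dimension is n iff every u is the first boundary value of an eigenvector.
   Let g_e(u) be the element of Ker(B^* - (x + ie)) with first boundary value u.
   Green's formula and the integral representation of N give
     |g_e|^2 = <K u, u> + \int d<Om u, u>(y) / ((y - x)^2 + e^2).
   If f is an eigenvector with boundary value u, then |g_e| <= |f|: monotone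
   convergence makes the singular integral finite, and Green's formula for
   g_e and f gives N(x + ie) -> L.  Conversely, if the integral is finite then
   g_e is bounded, and |g_e - g_d|^2 <= |g_d|^2 - |g_e|^2 for d < e makes it
   converge as e -> 0; the limit is an eigenvector with boundary values u, L u. *)
Require Import Defs.
From mathcomp Require Import all_boot all_order all_algebra.
From mathcomp Require Import all_classical all_reals all_analysis.
From mathcomp Require Import measurable_realfun complex.
From mathcomp Require Import ring lra.
Import Order.TTheory GRing.Theory Num.Theory.
Local Open Scope ring_scope.

Set Implicit Arguments.
Unset Strict Implicit.
Unset Printing Implicit Defensive.

(** * Auxiliary facts on sequences and choice *)

Lemma natSinv_lt (R : realType) (e : R) : 0 < e ->
  exists N, forall k, (N <= k)%N -> (k.+1%:R : R)^-1 < e.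
Proof.
move=> e0; have [N _ HN] := @near_infty_natSinv_lt R (PosNum e0).
by exists N => k /HN.
Qed.

Lemma choice_exists2 (T U : Type) (P Q : T -> U -> Prop) :
  (forall x, exists2 y, P x y & Q x y) ->
  exists f, forall x, P x (f x) /\ Q x (f x).
Proof.
move=> h; have /choice[f fP] x : exists y, P x y /\ Q x y.
  by have [y Py Qy] := h x; exists y.
by exists f.
Qed.

(** * Complex numbers and sequences through real and imaginary parts *)

Section ComplexFacts.
Variable R : realType.
Implicit Types z w : R[i].

(** The squared modulus as an element of [R]: estimates then avoid square roots and the partial
    order of [R[i]]. *)
Definition sqC z : R := reC z ^+ 2 + imC z ^+ 2.

Lemma reC_toC (x : R) : reC (toC x) = x. Proof. by []. Qed.
Lemma imC_toC (x : R) : imC (toC x) = 0. Proof. by []. Qed.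
Lemma reCD z w : reC (z + w) = reC z + reC w. Proof. by case: z; case: w. Qed.
Lemma imCD z w : imC (z + w) = imC z + imC w. Proof. by case: z; case: w. Qed.
Lemma reCN z : reC (- z) = - reC z. Proof. by case: z. Qed.
Lemma imCN z : imC (- z) = - imC z. Proof. by case: z. Qed.
Lemma reCM z w : reC (z * w) = reC z * reC w - imC z * imC w.
Proof. by case: z; case: w. Qed.
Lemma imCM z w : imC (z * w) = reC z * imC w + imC z * reC w.
Proof. by case: z => a b; case: w => c d /=; rewrite addrC. Qed.
Lemma conjCE z : (z^*)%R = (reC z -i* imC z)%C.
Proof. by case: z. Qed.
Lemma reC_conj z : reC (z^*)%R = reC z. Proof. by rewrite conjCE. Qed.
Lemma imC_conj z : imC (z^*)%R = - imC z. Proof. by rewrite conjCE. Qed.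

Definition reimE := (reCD, imCD, reCN, imCN, reCM, imCM, reC_conj, imC_conj,
  reC_toC, imC_toC).

Lemma eqCP z w : reC z = reC w -> imC z = imC w -> z = w.
Proof. by case: z => a b; case: w => c d /= -> ->. Qed.

Lemma sqC_ge0 z : 0 <= sqC z.
Proof. by rewrite addr_ge0 ?sqr_ge0. Qed.

Lemma sqCM z w : sqC (z * w) = sqC z * sqC w.
Proof. by rewrite /sqC !reimE; ring. Qed.

Lemma mulC_conj z : z * (z^*)%R = toC (sqC z).
Proof. by apply: eqCP; rewrite /sqC !reimE; ring. Qed.

(** In the order of [R[i]] a positive number is real, so the complex tolerances in the definitions
    can be replaced by real ones. *)
Lemma ltC0P z : 0 < z -> exists2 r : R, 0 < r & z = toC r.
Proof.
by case: z => a b; rewrite ltcE /= => /andP[/eqP-> a0]; exists a.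
Qed.

Lemma ltC_toC (r s : R) : (toC r < toC s) = (r < s).
Proof. by rewrite ltcE /= eqxx. Qed.

Lemma leC_toC (r s : R) : (toC r <= toC s) = (r <= s).
Proof. by rewrite lecE /= eqxx. Qed.

Lemma normC_lt z (e : R) : 0 < e -> (`|z| < toC e) = (sqC z < e ^+ 2).
Proof.
move=> e0; rewrite normc_def [X in X < _](_ : _ = toC (Num.sqrt (sqC z))).
  rewrite ltC_toC -[X in _ < X]ger0_norm ?ltW// -sqrtr_sqr ltr_sqrt//.
  by rewrite exprn_gt0.
by case: z.
Qed.

Lemma cvgCE (u : nat -> R[i]) (l : R[i]) : cvgC u l <->
  forall e : R, 0 < e -> exists N, forall k, (N <= k)%N -> sqC (u k - l) < e.
Proof.
split=> [h e e0|h _ /ltC0P[r r0 ->]].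
  have s0 : 0 < Num.sqrt e by rewrite sqrtr_gt0.
  have [|N HN] := h (toC (Num.sqrt e)); first by rewrite ltC_toC.
  by exists N => k /HN; rewrite normC_lt// sqr_sqrtr// ltW.
have [|N HN] := h (r ^+ 2); first by rewrite exprn_gt0.
by exists N => k /HN; rewrite normC_lt.
Qed.

Lemma cvgC_cst (l : R[i]) : cvgC (fun=> l) l.
Proof. by move=> e e0; exists 0%N => k _; rewrite subrr normr0. Qed.

Lemma cvgCD (u v : nat -> R[i]) l m :
  cvgC u l -> cvgC v m -> cvgC (fun k => u k + v k) (l + m).
Proof.
move=> ul vm e e0; have e2 : 0 < e / 2 by rewrite divr_gt0.
have [N HN] := ul _ e2; have [P HP] := vm _ e2.
exists (maxn N P) => k; rewrite geq_max => /andP[/HN h1 /HP h2].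
rewrite opprD addrACA (le_lt_trans (ler_normD _ _))//.
by rewrite [e]splitr ltrD.
Qed.

Lemma cvgCMl (u : nat -> R[i]) l a : cvgC u l -> cvgC (fun k => a * u k) (a * l).
Proof.
move=> /cvgCE ul; apply/cvgCE => e e0.
have a0 : 0 < sqC a + 1 by rewrite ltr_wpDl ?sqC_ge0.
have [N HN] := ul _ (divr_gt0 e0 a0); exists N => k /HN.
rewrite -mulrBr sqCM ltr_pdivlMr// mulrDr mulr1 mulrC.
by apply: le_lt_trans; rewrite lerDl sqC_ge0.
Qed.

Lemma cvgCM (u v : nat -> R[i]) l m :
  cvgC u l -> cvgC v m -> cvgC (fun k => u k * v k) (l * m).
Proof.
move=> ul vm.
have -> : (fun k => u k * v k) =
    fun k => (u k - l) * (v k - m) + (m * u k + l * (v k - m)).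
  by apply/funext => k; ring.
(* The limit is given the same shape, [0 + (m * l + l * (m - m))]. Only the product of the two
   differences is then not linear; one factor is made small and the other at most 1. *)
rewrite -[l * m]add0r (mulrC l) -[m * l]addr0 -[X in m * l + X](mulr0 l).
rewrite -{2}(subrr m); apply: cvgCD; last first.
  by apply: cvgCD; apply: cvgCMl => //; apply: cvgCD => //; exact: cvgC_cst.
apply/cvgCE => e e0.
have [N HN] := (cvgCE _ _).1 ul _ e0; have [P HP] := (cvgCE _ _).1 vm _ ltr01.
exists (maxn N P) => k; rewrite geq_max => /andP[/HN h1 /HP h2].
by rewrite subr0 sqCM -[e]mulr1 ltr_pM ?sqC_ge0.
Qed.

Lemma cvgC_sum n (u : nat -> 'I_n -> R[i]) l : (forall i, cvgC (u^~ i) (l i)) ->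
  cvgC (fun k => \sum_i u k i) (\sum_i l i).
Proof.
elim: n u l => [|n IHn] u l ul.
  rewrite big_ord0 [X in cvgC X](_ : _ = fun=> 0); first exact: cvgC_cst.
  by apply/funext => k; rewrite big_ord0.
rewrite big_ord_recl [X in cvgC X](_ : _ =
  fun k => u k ord0 + \sum_i u k (lift ord0 i)).
  by apply: cvgCD => //; apply: (IHn (fun k i => u k (lift ord0 i))).
by apply/funext => k; rewrite big_ord_recl.
Qed.

Lemma cvgC_unique (u : nat -> R[i]) l m : cvgC u l -> cvgC u m -> l = m.
Proof.
move=> ul um; apply/eqP; rewrite -subr_eq0 -normr_le0.
rewrite real_leNgt ?real0 ?normr_real//; apply/negP => e0.
have e2 : 0 < `|l - m| / 2 by rewrite divr_gt0.
have [N HN] := ul _ e2; have [P HP] := um _ e2.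
have := ltrD (HN _ (leq_maxl N P)) (HP _ (leq_maxr N P)).
rewrite -splitr (distrC _ l) => /(le_lt_trans (ler_normD _ _)).
by rewrite addrA subrK ltxx.
Qed.

Lemma cvgCB (u v : nat -> R[i]) l m :
  cvgC u l -> cvgC v m -> cvgC (fun k => u k - v k) (l - m).
Proof.
move=> ul vm; rewrite -[- m]mulN1r (_ : (fun k => _) = fun k => u k + -1 * v k).
  by apply: cvgCD => //; exact: cvgCMl.
by apply/funext => k; rewrite mulN1r.
Qed.

End ComplexFacts.

(** * Inner products and the projection theorem *)

Section InnerProduct.
Variables (R : realType) (H : lmodType R[i]) (ip : H -> H -> R[i]).
Hypothesis Hip : is_inner_product ip.
Implicit Types x y z : H.

Definition sqn x : R := reC (ip x x).

Lemma ipC x y : ip y x = ((ip x y)^*)%R. Proof. by case: Hip. Qed.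
Lemma ipDl x y z : ip (x + y) z = ip x z + ip y z.
Proof. by case: Hip => h _ _ _; rewrite -(scale1r x) h mul1r scale1r. Qed.
Lemma ip0l z : ip 0 z = 0.
Proof. by apply: (addrI (ip 0 z)); rewrite -ipDl !addr0. Qed.
Lemma ipZl a x z : ip (a *: x) z = a * ip x z.
Proof. by case: Hip => h _ _ _; rewrite -(addr0 (a *: x)) h ip0l addr0. Qed.
Lemma ipNl x z : ip (- x) z = - ip x z.
Proof. by rewrite -scaleN1r ipZl mulN1r. Qed.
Lemma ipBl x y z : ip (x - y) z = ip x z - ip y z.
Proof. by rewrite ipDl ipNl. Qed.
Lemma ipDr x y z : ip x (y + z) = ip x y + ip x z.
Proof. by rewrite ipC ipDl rmorphD /= -!ipC. Qed.
Lemma ip0r x : ip x 0 = 0. Proof. by rewrite ipC ip0l rmorph0. Qed.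
Lemma ipZr a x y : ip x (a *: y) = (a^*)%R * ip x y.
Proof. by rewrite ipC ipZl rmorphM /= -ipC. Qed.
Lemma ipNr x y : ip x (- y) = - ip x y.
Proof. by rewrite ipC ipNl rmorphN /= -ipC. Qed.
Lemma ipBr x y z : ip x (y - z) = ip x y - ip x z.
Proof. by rewrite ipDr ipNr. Qed.

Definition ipE := (ipDl, ipDr, ipZl, ipZr, ipNl, ipNr, ip0l, ip0r).

Lemma ipxx x : ip x x = toC (sqn x).
Proof.
have [_ _ /(_ x) + _] := Hip; rewrite /sqn; case: (ip x x) => a b.
by rewrite lecE /= => /andP[/eqP-> _].
Qed.

Lemma sqn_ge0 x : 0 <= sqn x.
Proof. by have [_ _ /(_ x) + _] := Hip; rewrite ipxx lecE => /andP[]. Qed.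

Lemma sqn_eq0 x : sqn x = 0 -> x = 0.
Proof. by have [_ _ _ h] := Hip => x0; apply: h; rewrite ipxx x0. Qed.

Lemma sqnD x y : sqn (x + y) = sqn x + sqn y + 2 * reC (ip x y).
Proof. by rewrite /sqn !ipE !reimE (ipC x y) !reimE; ring. Qed.

Lemma sqnN x : sqn (- x) = sqn x.
Proof. by rewrite /sqn !ipE opprK. Qed.

Lemma sqnB x y : sqn (x - y) = sqn x + sqn y - 2 * reC (ip x y).
Proof. by rewrite sqnD sqnN ipNr !reimE mulrN. Qed.

Lemma sqnBC x y : sqn (x - y) = sqn (y - x).
Proof. by rewrite -sqnN opprB. Qed.

Lemma sqnZ a x : sqn (a *: x) = sqC a * sqn x.
Proof. by rewrite /sqn ipZl ipZr mulrA mulC_conj ipxx !reimE mul0r subr0. Qed.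

Lemma parallelogram x y : sqn (x - y) = 2 * sqn x + 2 * sqn y - sqn (x + y).
Proof. by rewrite sqnB sqnD; ring. Qed.

Lemma sqnD_le x y : sqn (x + y) <= 2 * sqn x + 2 * sqn y.
Proof. by have := sqn_ge0 (x - y); rewrite parallelogram subr_ge0. Qed.

(** The squared norm of [toC (sqn y) *: x - ip x y *: y] is [sqn y] times the difference of the two
    sides. *)
Lemma cauchy_schwarz x y : sqC (ip x y) <= sqn x * sqn y.
Proof.
have [y0|y0] := eqVneq (sqn y) 0.
  by rewrite (sqn_eq0 y0) ip0r /sqC /= expr0n addr0 mulr_ge0 ?sqn_ge0.
have yp : 0 < sqn y by rewrite lt_def y0 sqn_ge0.
rewrite -subr_ge0 -(pmulr_rge0 _ yp).
suff -> : sqn y * (sqn x * sqn y - sqC (ip x y)) =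
    sqn (toC (sqn y) *: x - ip x y *: y) by exact: sqn_ge0.
rewrite sqnB !sqnZ ipZl ipZr /sqC !reimE /=; ring.
Qed.

Lemma hcvgE (u : nat -> H) x : hcvg ip u x <->
  forall e : R, 0 < e -> exists N, forall k, (N <= k)%N -> sqn (u k - x) < e.
Proof.
split=> [h e e0|h _ /ltC0P[r r0 ->]].
  have [|N HN] := h (toC e); first by rewrite ltC_toC.
  by exists N => k /HN; rewrite ipxx ltC_toC.
by have [N HN] := h r r0; exists N => k /HN; rewrite ipxx ltC_toC.
Qed.

Lemma hcauchyP (u : nat -> H) :
  (forall e : R, 0 < e -> exists N, forall k m, (N <= k)%N -> (N <= m)%N ->
     sqn (u k - u m) < e) -> hcauchy ip u.
Proof.
move=> h _ /ltC0P[r r0 ->]; have [N HN] := h r r0.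
by exists N => k m Nk Nm; rewrite ipxx ltC_toC; apply: HN.
Qed.

Lemma hcvg_cauchy (u : nat -> H) x : hcvg ip u x ->
  forall e : R, 0 < e -> exists N, forall k m, (N <= k)%N -> (N <= m)%N ->
     sqn (u k - u m) < e.
Proof.
move=> /hcvgE h e e0; have e4 : 0 < e / 4 by rewrite divr_gt0.
have [N HN] := h _ e4; exists N => k m /HN hk /HN hm.
have := sqnD_le (u k - x) (x - u m); rewrite addrA subrK (sqnBC x); lra.
Qed.

Lemma hcvg_ip (u : nat -> H) x y :
  hcvg ip u x -> cvgC (fun k => ip (u k) y) (ip x y).
Proof.
move=> /hcvgE ux; apply/cvgCE => e e0.
have y0 : 0 < sqn y + 1 by rewrite ltr_wpDl ?sqn_ge0.
have [N HN] := ux _ (divr_gt0 e0 y0); exists N => k /HN.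
rewrite -ipBl ltr_pdivlMr// mulrDr mulr1; apply: le_lt_trans.
by rewrite (le_trans (cauchy_schwarz _ _))// lerDl sqn_ge0.
Qed.

Lemma hcvgZ (c : R[i]) (u : nat -> H) x :
  hcvg ip u x -> hcvg ip (fun k => c *: u k) (c *: x).
Proof.
move=> /hcvgE ux; apply/hcvgE => e e0.
have c0 : 0 < sqC c + 1 by rewrite ltr_wpDl ?sqC_ge0.
have [N HN] := ux _ (divr_gt0 e0 c0); exists N => k /HN.
rewrite -scalerBr sqnZ ltr_pdivlMr// mulrDr mulr1 mulrC; apply: le_lt_trans.
by rewrite lerDl sqn_ge0.
Qed.

Lemma hcvgD (u v : nat -> H) x y : hcvg ip u x -> hcvg ip v y ->
  hcvg ip (fun k => u k + v k) (x + y).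
Proof.
move=> /hcvgE ux /hcvgE vy; apply/hcvgE => e e0.
have e4 : 0 < e / 4 by rewrite divr_gt0.
have [N HN] := ux _ e4; have [P HP] := vy _ e4.
exists (maxn N P) => k; rewrite geq_max => /andP[/HN hk /HP hm].
rewrite opprD addrACA; apply: le_lt_trans (sqnD_le _ _) _; lra.
Qed.

Lemma orth_dense (D : set H) x :
  dense_dom ip D -> (forall d, D d -> ip x d = 0) -> x = 0.
Proof.
move=> Dd xD; apply/eqP; apply/negPn/negP => /eqP x0.
have xp : 0 < sqn x.
  by rewrite lt_def sqn_ge0 andbT; apply/eqP => /sqn_eq0.
have [|d Dxd] := Dd x (toC (sqn x)); first by rewrite ltC_toC.
by rewrite ipxx ltC_toC sqnB (xD _ Dxd) /= mulr0 subr0 gtrDl ltNge sqn_ge0.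
Qed.

Hypothesis Hc : forall u, hcauchy ip u -> exists x, hcvg ip u x.

(** A minimizing sequence in [L] is Cauchy by the parallelogram law, and its limit is the
    projection. *)
Theorem projection_exists (L : set H) x :
  lin_subspace L -> hclosed ip L -> exists l, is_proj ip L x l.
Proof.
move=> [L0 Llin] Lcl.
pose S := [set sqn (x - l) | l in L]%classic.
have Sinf : has_inf S.
  split; first by exists (sqn (x - 0)), 0.
  by exists 0 => _ [l _ <-]; exact: sqn_ge0.
set d := inf S.
have dle l : L l -> d <= sqn (x - l).
  by move=> Ll; apply: ge_inf; [case: Sinf|exists l].
have exl k : exists l, L l /\ sqn (x - l) < d + k.+1%:R^-1.
  have [|_ [l Ll <-] h] := @inf_adherent _ S k.+1%:R^-1 _ Sinf.
    by rewrite invr_gt0.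
  by exists l.
have [u uP] := choice exl.
have ucau : hcauchy ip u.
  apply: hcauchyP => e e0.
  have [|N HN] := @natSinv_lt R (e / 4); first by rewrite divr_gt0.
  exists N => k m /HN hk /HN hm.
  rewrite (_ : u k - u m = (x - u m) - (x - u k)); last first.
    by rewrite opprB [RHS]addrC addrA subrK.
  rewrite parallelogram.
  (* The midpoint lies in [L], so its squared distance to [x] is at least [d]; this bounds the
     subtracted term of the parallelogram law from below. *)
  have Lh : L (2^-1 *: u m + 2^-1 *: u k).
    have [[Lk _] [Lm _]] := (uP k, uP m).
    by apply: (Llin) => //; rewrite -(addr0 (_ *: _)); exact: Llin.
  have := dle _ Lh.
  have -> : (x - u m + (x - u k)) = 2 *: (x - (2^-1 *: u m + 2^-1 *: u k)).
    rewrite scalerBr scalerDr !scalerA divff ?scale1r ?pnatr_eq0//.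
    by rewrite scaler_nat mulr2n opprD addrACA.
  rewrite sqnZ (_ : sqC 2 = 4); last by rewrite /sqC mulr2n !reimE /=; ring.
  have [_ h1] := uP k; have [_ h2] := uP m.
  set s := sqn (x - (_ + _)) => h3.
  move: (k.+1%:R^-1) (m.+1%:R^-1) hk hm h1 h2 => a b hk hm h1 h2; lra.
have [l ul] := Hc ucau; exists l.
split; first by apply: Lcl ul => k; case: (uP k).
move=> m Lm; apply: (@cvgC_unique _ (fun k => ip (x - u k) m)).
  rewrite ipBl (_ : (fun k => _) = fun k => ip x m - ip (u k) m).
    by apply: cvgCB; [exact: cvgC_cst|exact: hcvg_ip].
  by apply/funext => k; rewrite ipBl.
apply/cvgCE => e e0.
have m0 : 0 < sqn m + 1 by rewrite ltr_wpDl ?sqn_ge0.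
have [N HN] := natSinv_lt (divr_gt0 e0 m0).
exists N => k /HN hk; rewrite subr0.
have [y0|y0] := eqVneq (sqn m) 0.
  by rewrite (sqn_eq0 y0) ip0r /sqC /= expr0n addr0.
have yp : 0 < sqn m by rewrite lt_def y0 sqn_ge0.
(* The coefficient of [x - u k] along [m]. Moving [u k] by [c *: m] stays in [L] and lowers the
   squared distance by [sqC c * sqn m], which is therefore below [k.+1%:R^-1]. *)
set c := ip (x - u k) m / toC (sqn m).
have [Luk huk] := uP k.
have := dle _ (Llin c _ _ Lm Luk).
have -> : x - (c *: m + u k) = (x - u k) - c *: m.
  by rewrite opprD addrA addrAC.
have ipc : ip (x - u k) m = c * toC (sqn m).
  by rewrite /c divfK// eq_complex /= (negPf y0).
have reE : reC ((c^*)%R * (c * toC (sqn m))) = sqC c * sqn m.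
  by rewrite mulrA (mulrC _ c) mulC_conj !reimE mul0r subr0.
rewrite sqnB sqnZ ipZr ipc reE sqCM => h.
have h2 : sqC c * sqn m < k.+1%:R^-1.
  by move: (k.+1%:R^-1) huk h => a huk h; lra.
rewrite (_ : sqC (toC _) = sqn m * sqn m); last by rewrite /sqC /=; ring.
rewrite mulrA; move: hk; rewrite ltr_pdivlMr//; apply: le_lt_trans.
apply: (@le_trans _ _ (k.+1%:R^-1 * sqn m)).
  by rewrite ler_wpM2r ?sqn_ge0// ltW.
by rewrite ler_pM2l ?invr_gt0// lerDl.
Qed.

End InnerProduct.
(** * Ranges of closed symmetric operators *)

Section SymmetricOperators.
Variables (R : realType) (H : lmodType R[i]) (ip : H -> H -> R[i]).
Hypothesis HH : is_hilbert ip.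
Let Hip : is_inner_product ip := HH.1.
Variables (D : set H) (T : H -> H).
Hypothesis T_op : operator D T.
Hypothesis T_sym : symmetric_op ip D T.

Lemma operatorB d e : D d -> D e -> D (d - e) /\ T (d - e) = T d - T e.
Proof.
have [[_ Dlin] Tlin] := T_op; move=> Dd De.
rewrite [d - e]addrC -scaleN1r; split; first exact: Dlin.
by rewrite Tlin// scaleN1r addrC.
Qed.

Lemma operatorZ (a : R[i]) d : D d -> D (a *: d) /\ T (a *: d) = a *: T d.
Proof.
have [[D0 Dlin] Tlin] := T_op; move=> Dd.
have [_] := operatorB D0 D0; rewrite !subrr => T0.
by rewrite -(addr0 (a *: d)); split; [exact: Dlin|rewrite Tlin// T0 addr0].
Qed.

Lemma symmetric_im0 d : D d -> imC (ip (T d) d) = 0.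
Proof.
move=> Dd; have : imC (ip (T d) d) = - imC (ip (T d) d).
  by rewrite -imC_conj -(ipC Hip) T_sym.
lra.
Qed.

(** Since [ip (T d) d] is real, the real shift of [T d] and the imaginary multiple of [d] contribute
    no cross term, and Pythagoras applies. Injectivity, closed range and the resolvent bound all
    rest on this estimate. *)
Lemma symmetric_shift_ge z d : D d -> imC z ^+ 2 * sqn ip d <= sqn ip (T d - z *: d).
Proof.
move=> Dd.
have -> : T d - z *: d = (T d - toC (reC z) *: d) - (0 +i* imC z)%C *: d.
  have zE : z = toC (reC z) + (0 +i* imC z)%C.
    by apply: eqCP; rewrite !reimE /= ?addr0 ?add0r.
  by rewrite {1}zE scalerDl opprD addrA.
rewrite (sqnB Hip) (sqnZ Hip) (ipBl Hip) (ipZr Hip) (ipZr Hip) (ipZl Hip) (ipxx Hip) !reimE.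
rewrite /sqC /= symmetric_im0// expr0n /=.
have := sqn_ge0 Hip (T d - toC (reC z) *: d); lra.
Qed.

Hypothesis T_closed : closed_op ip D T.
Variable z : R[i].
Hypothesis z_im : imC z != 0.

Let rangez : set H := fun g => exists2 d, D d & T d - z *: d = g.

Lemma range_subspace : lin_subspace rangez.
Proof.
have [[D0 Dlin] Tlin] := T_op; split.
  exists (0 - 0) => //; first by rewrite subr0.
  have [_ ->] := operatorB D0 D0.
  by rewrite !subrr scaler0 subr0.
move=> a _ _ [x Dx <-] [y Dy <-]; exists (a *: x + y); first exact: Dlin.
rewrite Tlin// scalerDr scalerBr !scalerA (mulrC z) opprD.
by rewrite !addrA; congr (_ + _); rewrite -!addrA; congr (_ + _); rewrite addrC.
Qed.

(** By [symmetric_shift_ge] the preimages of a convergent sequence are Cauchy, and closedness of [T]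
    carries the equation to their limit. *)
Lemma range_closed : hclosed ip rangez.
Proof.
move=> u x uR ux.
have [d dP] := choice_exists2 uR.
have b0 : 0 < imC z ^+ 2 by rewrite lt_def sqr_ge0 sqrf_eq0 z_im.
have [|d' dd'] := HH.2 d.
  apply: hcauchyP => // e e0.
  have [|N HN] := hcvg_cauchy Hip ux (e := imC z ^+ 2 * e); first exact: mulr_gt0.
  exists N => k m Nk Nm; rewrite -(ltr_pM2l b0).
  apply: le_lt_trans (HN _ _ Nk Nm).
  have [[Dk <-] [Dm <-]] := (dP k, dP m).
  have [Dkm Tkm] := operatorB Dk Dm.
  rewrite (_ : _ - _ - _ = T (d k - d m) - z *: (d k - d m)).
    exact: symmetric_shift_ge.
  by rewrite Tkm scalerBr !opprD !opprK !addrA; congr (_ + _); rewrite addrAC.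
have [||Dd' Td'] := @T_closed d d' (x + z *: d') _ dd'.
- by move=> k; case: (dP k).
- rewrite (_ : T \o d = fun k => u k + z *: d k).
    by apply: hcvgD => //; exact: hcvgZ.
  by apply/funext => k /=; have [_ <-] := dP k; rewrite subrK.
by exists d' => //; rewrite Td' addrK.
Qed.

(** The component [p] orthogonal to the range satisfies the adjoint equation at the conjugate of
    [z]; each use below shows that it vanishes. *)
Lemma range_decomposition g : exists d p, [/\ D d, g = T d - z *: d + p &
  forall e, D e -> ip p (T e - z *: e) = 0].
Proof.
have [_ [[d Dd <-] Hl]] := projection_exists Hip HH.2 g range_subspace range_closed.
exists d, (g - (T d - z *: d)); split => //; first by rewrite addrC subrK.
by move=> e De; apply: Hl; exists e.
Qed.

End SymmetricOperators.

(** * Boundary triplets *)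

Section BoundaryTriplet.
Variables (R : realType) (H : lmodType R[i]) (ip : H -> H -> R[i]).
Hypothesis HH : is_hilbert ip.
Let Hip : is_inner_product ip := HH.1.
Variables (DB : set H) (B : H -> H) (DBs : set H) (Bs : H -> H).
Hypothesis B_op : operator DB B.
Hypothesis B_dense : dense_dom ip DB.
Hypothesis B_closed : closed_op ip DB B.
Hypothesis B_sym : symmetric_op ip DB B.
Hypothesis B_adj : adjoint_of ip DB B DBs Bs.

(** Density of [DB] makes the representing vector unique, so [w] has to be [Bs y]. *)
Lemma adjoint_intro y w :
  (forall x, DB x -> ip (B x) y = ip x w) -> DBs y /\ Bs y = w.
Proof.
move=> h; have Dy : DBs y by apply/B_adj.1; exists w.
split => //; apply/eqP; rewrite -subr_eq0; apply/eqP.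
apply: (orth_dense Hip B_dense) => d Dd.
by rewrite (ipC Hip) (ipBr Hip) -h// -(B_adj.2 _ _ Dy Dd) subrr rmorph0.
Qed.

Lemma adjoint_extends d : DB d -> DBs d /\ Bs d = B d.
Proof. by move=> Dd; apply: adjoint_intro => x Dx; exact: B_sym. Qed.

Lemma adjoint_operator : operator DBs Bs.
Proof.
have lin (a : R[i]) x y : DBs x -> DBs y ->
    DBs (a *: x + y) /\ Bs (a *: x + y) = a *: Bs x + Bs y.
  move=> Dx Dy; apply: adjoint_intro => d Dd.
  by rewrite (ipDr Hip) (ipZr Hip) (ipDr Hip) (ipZr Hip) !(B_adj.2 _ d).
split; [split|] => [|a x y Dx Dy|a x y Dx Dy].
- have [|//] := @adjoint_intro 0 0; move=> x Dx.
  by rewrite !(ip0r Hip).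
- by case: (lin a x y Dx Dy).
- by case: (lin a x y Dx Dy).
Qed.

Variables (n : nat) (G1 G2 : H -> 'cV[R[i]]_n).
Hypothesis triplet : boundary_triplet ip DBs Bs G1 G2.
Implicit Types u v : 'cV[R[i]]_n.

Lemma ipn0l v : ipn 0 v = 0.
Proof. by rewrite /ipn big1// => i _; rewrite mxE mul0r. Qed.

Lemma ipnC u v : ipn v u = ((ipn u v)^*)%R.
Proof.
rewrite /ipn rmorph_sum; apply: eq_bigr => i _.
by rewrite rmorphM /= conjCK mulrC.
Qed.

Lemma ipn0r v : ipn v 0 = 0.
Proof. by rewrite ipnC ipn0l rmorph0. Qed.

Lemma ipnBl u v w : ipn (u - v) w = ipn u w - ipn v w.
Proof.
by rewrite /ipn -sumrB; apply: eq_bigr => i _; rewrite !mxE mulrBl.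
Qed.

Lemma ipnBr u v w : ipn u (v - w) = ipn u v - ipn u w.
Proof. by rewrite ipnC ipnBl rmorphB /= -!ipnC. Qed.

Lemma ipn_eq0 u : ipn u u = 0 -> u = 0.
Proof.
move/eqP; rewrite psumr_eq0; last by move=> i _; exact: mul_conjC_ge0.
move/allP => h.
apply/colP => i; rewrite !mxE; apply/eqP.
have := h i (mem_index_enum i); rewrite /= mulf_eq0 conjC_eq0.
by case/orP.
Qed.

Lemma ipn_hermitian (A : 'M[R[i]]_n) u v :
  hermitian_mx A -> ipn (A *m u) v = ipn u (A *m v).
Proof.
move=> hA; rewrite /ipn.
under eq_bigr => i _ do rewrite mxE mulr_suml.
under [RHS]eq_bigr => i _ do rewrite mxE rmorph_sum mulr_sumr.
rewrite exchange_big; apply: eq_bigr => i _; apply: eq_bigr => j _ /=.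
by rewrite rmorphM /= -hA mulrCA mulrA.
Qed.

Lemma qform_ipn (A : 'M[R[i]]_n) u : qform A u = ipn (A *m u) u.
Proof.
rewrite /qform /ipn; apply: eq_bigr => i _; rewrite mxE mulr_suml.
by apply: eq_bigr => j _; rewrite -mulrA mulrC.
Qed.

Lemma green x y : DBs x -> DBs y ->
  ip (Bs x) y - ip x (Bs y) = ipn (G2 x) (G1 y) - ipn (G1 x) (G2 y).
Proof. by case: triplet => _ _ h _; exact: h. Qed.

Lemma Gamma_onto u v : exists f, [/\ DBs f, G1 f = u & G2 f = v].
Proof. by case: triplet. Qed.

Lemma Gamma_lin a x y : DBs x -> DBs y ->
  G1 (a *: x + y) = a *: G1 x + G1 y /\ G2 (a *: x + y) = a *: G2 x + G2 y.
Proof. by case: triplet => h1 h2 _ _ Dx Dy; split; [exact: h1|exact: h2]. Qed.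

Lemma GammaB x y : DBs x -> DBs y ->
  G1 (x - y) = G1 x - G1 y /\ G2 (x - y) = G2 x - G2 y.
Proof.
move=> Dx Dy; rewrite addrC -scaleN1r; have [-> ->] := Gamma_lin (-1) Dy Dx.
by rewrite !scaleN1r !(addrC (- _)).
Qed.

(* Surjectivity of (Gamma_1, Gamma_2) makes the boundary form nondegenerate. *)
Lemma boundary_values_unique f u v : DBs f ->
  (forall y, DBs y -> ip (Bs f) y - ip f (Bs y) = ipn v (G1 y) - ipn u (G2 y)) ->
  G1 f = u /\ G2 f = v.
Proof.
move=> Df h.
have e y : DBs y -> ipn (G2 f - v) (G1 y) = ipn (G1 f - u) (G2 y).
  move=> Dy; have := h y Dy; rewrite green// !ipnBl => E.
  by apply/eqP; rewrite -subr_eq0; apply/eqP; move/eqP: E; rewrite -subr_eq0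
    => /eqP <-; ring.
split; apply/eqP; rewrite -subr_eq0; apply/eqP/ipn_eq0.
  have [y [Dy y1 y2]] := Gamma_onto 0 (G1 f - u).
  by have := e y Dy; rewrite y1 y2 ipn0r.
have [y [Dy y1 y2]] := Gamma_onto (G2 f - v) 0.
by have := e y Dy; rewrite y1 y2 ipn0r.
Qed.

(** On [DB] the boundary form against every [y] is zero, and the form is nondegenerate. *)
Lemma Gamma_vanish d : DB d -> G1 d = 0 /\ G2 d = 0.
Proof.
move=> Dd; have [Dsd Bsd] := adjoint_extends Dd.
apply: boundary_values_unique => // y Dy.
by rewrite !ipn0l Bsd (B_adj.2 y d)// !subrr.
Qed.

(** Testing against [DB] puts [y] into the domain of the adjoint. Green's formula with an [x] such
    that [G1 x = 0] and [G2 x = G1 y] then leaves [ipn (G1 y) (G1 y) = 0]. *)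
Lemma A1_selfadjoint y w :
  (forall x, DBs x -> G1 x = 0 -> ip (Bs x) y = ip x w) ->
  [/\ DBs y, Bs y = w & G1 y = 0].
Proof.
move=> h; have [|Dy Byw] := @adjoint_intro y w.
  move=> x Dx; have [Dsx <-] := adjoint_extends Dx.
  by apply: h => //; case: (Gamma_vanish Dx).
split => //; apply: ipn_eq0.
have [x [Dx x1 x2]] := Gamma_onto 0 (G1 y).
have := green Dx Dy; rewrite x1 x2 ipn0l subr0 => <-.
by rewrite Byw h// subrr.
Qed.

Lemma ext_symmetric E : hermitian_mx E ->
  symmetric_op ip (ext_dom DBs G1 G2 E) Bs.
Proof.
move=> hE x y [Dx x2] [Dy y2]; apply/eqP; rewrite -subr_eq0 green// x2 y2.
by rewrite ipn_hermitian// subrr.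
Qed.

Lemma A1_symmetric : symmetric_op ip (A1_dom DBs G1) Bs.
Proof.
move=> x y [Dx x1] [Dy y1]; apply/eqP; rewrite -subr_eq0 green// x1 y1.
by rewrite ipn0l ipn0r subrr.
Qed.

Lemma A1_operator : operator (A1_dom DBs G1) Bs.
Proof.
have [[D0 Dlin] Blin] := adjoint_operator; split; [split|].
- have [B0 _] := GammaB D0 D0.
  by split => //; rewrite -(subr0 0) B0 subrr.
- move=> a x y [Dx x1] [Dy y1]; split; first exact: Dlin.
  by have [-> _] := Gamma_lin a Dx Dy; rewrite x1 y1 scaler0 addr0.
- by move=> a x y [Dx _] [Dy _]; exact: Blin.
Qed.

Lemma A1_closed : closed_op ip (A1_dom DBs G1) Bs.
Proof.
move=> u x y uD ux uy.
have [|Dx Bx x1] := @A1_selfadjoint x y; last by [].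
move=> e De e1; rewrite (ipC Hip x) (ipC Hip y); congr (_^*)%R.
apply: (@cvgC_unique _ (fun k => ip (u k) (Bs e))); first exact: hcvg_ip.
rewrite (_ : (fun k => _) = fun k => ip ((Bs \o u) k) e); first exact: hcvg_ip.
by apply/funext => k; rewrite /= A1_symmetric.
Qed.

Lemma symmetric_injective D T (z : R[i]) f : symmetric_op ip D T -> imC z != 0 ->
  D f -> T f - z *: f = 0 -> f = 0.
Proof.
move=> Tsym z0 Df Tf; apply: (sqn_eq0 Hip); apply/eqP.
have := symmetric_shift_ge HH Tsym z Df.
rewrite Tf {2}/sqn (ip0l Hip) /= => h.
have /eqP : imC z ^+ 2 * sqn ip f == 0.
  by rewrite eq_le h mulr_ge0 ?sqr_ge0 ?sqn_ge0.
by move/eqP; rewrite mulf_eq0 sqrf_eq0 (negPf z0).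
Qed.

(** By self-adjointness of [A_1], a vector orthogonal to the range solves the eigenvalue equation at
    the conjugate of [z], and a symmetric operator has no nonreal eigenvalue. *)
Lemma A1_onto (z : R[i]) g : imC z != 0 ->
  exists f, [/\ DBs f, G1 f = 0 & Bs f - z *: f = g].
Proof.
move=> z0.
have [f [p [[Df f1] -> hp]]] :=
  range_decomposition HH A1_operator A1_symmetric A1_closed z0 g.
suff -> : p = 0 by exists f; rewrite addr0.
have [|Dp Bp p1] := @A1_selfadjoint p ((z^*)%R *: p).
  move=> x Dx x1; have := hp x (conj Dx x1).
  rewrite (ipBr Hip) (ipZr Hip) => /eqP; rewrite subr_eq0 => /eqP e.
  by rewrite (ipC Hip p) e (ipZr Hip) rmorphM /= -(ipC Hip).
apply: (symmetric_injective A1_symmetric (z := (z^*)%R)).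
- by rewrite imC_conj oppr_eq0.
- by split.
- by rewrite Bp subrr.
Qed.

(** Brings every nonreal [z] into the scope of [weyl_function], which speaks of the resolvent set of
    [A_1] only. *)
Lemma A1_resolvent (z : R[i]) : imC z != 0 -> in_resolvent ip (A1_dom DBs G1) Bs z.
Proof.
move=> z0; have b0 : 0 < imC z ^+ 2 by rewrite lt_def sqr_ge0 sqrf_eq0 z0.
split.
- by move=> g; have [f [Df f1 e]] := A1_onto g z0; exists f.
- by move=> f Df; exact: (symmetric_injective A1_symmetric).
- exists (toC (imC z ^- 2)) => f Df; rewrite !(ipxx Hip).
  rewrite (_ : toC _ * toC _ =
    toC (imC z ^- 2 * sqn ip (Bs f - z *: f))); last first.
    by apply: eqCP; rewrite !reimE; ring.
  rewrite leC_toC mulrC ler_pdivlMr// mulrC.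
  exact: (symmetric_shift_ge HH A1_symmetric).
Qed.

(** Any [f0] with [G1 f0 = u] is corrected by the solution [h] in the domain of [A_1] of
    [Bs h - z *: h = Bs f0 - z *: f0]. *)
Lemma gamma_exists (z : R[i]) u : imC z != 0 ->
  exists2 g, kerz DBs Bs z g & G1 g = u.
Proof.
move=> z0; have [f0 [Df0 f01 _]] := Gamma_onto u 0.
have [h [Dh h1 e]] := A1_onto (Bs f0 - z *: f0) z0.
have [[Dg Bg] [g1 _]] := (operatorB adjoint_operator Df0 Dh, GammaB Df0 Dh).
exists (f0 - h); last by rewrite g1 f01 h1 subr0.
split => //; rewrite Bg scalerBr -(subrK (z *: h) (Bs h)) e.
by rewrite opprD opprB addrA [X in X - _]addrC subrK.
Qed.

(* B is closed, so B^** = B. *)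
Lemma ker_Gamma f : DBs f -> G1 f = 0 -> G2 f = 0 -> DB f.
Proof.
move=> Df f1 f2.
have i0 : imC (0 +i* 1 : R[i])%C != 0 by exact: oner_neq0.
have [d [p [Dd e hp]]] :=
  range_decomposition HH B_op B_sym B_closed i0 (Bs f - (0 +i* 1)%C *: f).
have [Dsd Bsd] := adjoint_extends Dd; have [d1 d2] := Gamma_vanish Dd.
have [|Dp Bp] := @adjoint_intro p (((0 +i* 1)%C^*)%R *: p).
  move=> x Dx; have /eqP := hp x Dx.
  rewrite (ipBr Hip) (ipZr Hip) subr_eq0 => /eqP E.
  by rewrite (ipC Hip p) E (ipZr Hip) rmorphM /= -(ipC Hip).
have [[Dw Bw] [w1 w2]] := (operatorB adjoint_operator Df Dsd, GammaB Df Dsd).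
rewrite f1 d1 subrr in w1; rewrite f2 d2 subrr in w2.
have pw : Bs (f - d) - (0 +i* 1)%C *: (f - d) = p.
  have -> : p = Bs f - (0 +i* 1)%C *: f - (B d - (0 +i* 1)%C *: d).
    by rewrite e addrC addKr.
  by rewrite Bw Bsd scalerBr !opprD !opprK !addrA; congr (_ + _); rewrite addrAC.
(* The vector [f - d] has zero boundary values and [Bs p] is [-i] times [p], so Green's formula
   makes [p], the image of [f - d] under [Bs - i], orthogonal to itself. *)
have p0 : p = 0.
  apply: (sqn_eq0 Hip); rewrite /sqn -{1}pw (ipBl Hip) (ipZl Hip).
  have := green Dw Dp; rewrite w1 w2 !ipn0l subrr => /eqP.
  rewrite subr_eq0 Bp (ipZr Hip) => /eqP ->.
  by rewrite conjCK subrr.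
rewrite p0 in pw.
(* With [p = 0], [f - d] solves the eigenvalue equation of [A_1] at [i], hence vanishes and
   [f = d]. *)
suff /eqP : f - d = 0 by rewrite subr_eq0 => /eqP ->.
by apply: (symmetric_injective A1_symmetric i0).
Qed.

(** By [ker_Gamma] such an [f] lies in [DB]. The eigenspace of [B] at the real number [x] is closed
    and reducing, and [B] acts on it as multiplication by [x], which is self-adjoint; complete
    non-selfadjointness makes it trivial. *)
Lemma no_eigenvector (x : R) f : completely_nonselfadjoint ip DB B ->
  DBs f -> G1 f = 0 -> G2 f = 0 -> Bs f = toC x *: f -> f = 0.
Proof.
move=> cns Df f1 f2 Bf; have DBf := ker_Gamma Df f1 f2.
have [_ Bsf] := adjoint_extends DBf.
have [[D0 Dlin] Blin] := B_op.
have xr : ((toC x)^*)%R = toC x by apply: eqCP; rewrite !reimE ?oppr0.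
apply: (cns (kerz DB B (toC x))); last by split; rewrite // -Bsf.
- split.
    split => //; have [_] := operatorB B_op D0 D0.
    by rewrite !subrr scaler0.
  move=> a u v [Du Bu] [Dv Bv]; split; first exact: Dlin.
  by rewrite Blin// Bu Bv scalerDr !scalerA mulrC.
- move=> u y uK uy; have [Dy By] : DB y /\ B y = toC x *: y.
    apply: (B_closed (u := u)) => //; first by move=> k; case: (uK k).
    rewrite (_ : B \o u = fun k => toC x *: u k); first exact: hcvgZ.
    by apply/funext => k /=; case: (uK k).
  by split.
- move=> y l Dy [[Dl Bl] yl]; split => //; rewrite Bl; split.
    by have [? Bxl] := operatorZ B_op (toC x) Dl; split => //; rewrite Bxl Bl.
  move=> m [Dm Bm]; rewrite (ipBl Hip) B_sym// Bm (ipZr Hip) (ipZl Hip) xr -mulrBr -(ipBl Hip).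
  by rewrite yl ?mulr0.
- split.
  + move=> y Dy [_ By]; rewrite By.
    by have [? Bxy] := operatorZ B_op (toC x) Dy; split => //; rewrite Bxy By.
  + move=> y e [Dy By] e0; exists y; first by split => //; split.
    by rewrite subrr (ip0l Hip).
  + by move=> u v Du _ Dv _; exact: B_sym.
  + by move=> y [].
Qed.

End BoundaryTriplet.
(** * The Poisson kernel and the singular integral *)

Section PoissonKernel.
Import numFieldNormedType.Exports.
Local Open Scope classical_set_scope.
Variable R : realType.
Implicit Types x y e : R.

(** The Poisson kernel of the half plane without its factor [e] over pi, so that it increases to
    [inv_sq_kernel] as [e] decreases to 0. *)
Definition pois x e y : R := ((y - x) ^+ 2 + e ^+ 2)^-1.

Lemma pois_ge0 x e y : 0 <= pois x e y.
Proof. by rewrite invr_ge0 addr_ge0 ?sqr_ge0. Qed.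

Lemma herglotz_kernel_im x e y :
  imC (herglotz_kernel (x +i* e)%C y) = e * pois x e y.
Proof.
rewrite /herglotz_kernel !reimE oppr0 addr0 /pois.
have -> : toC y - (x +i* e)%C = ((y - x) +i* - e)%C.
  by apply: eqCP; rewrite !reimE /= ?add0r.
by rewrite /= sqrrN mulNr opprK.
Qed.

Lemma cvg_pois x y :
  (fun k => (pois x k.+1%:R^-1 y)%:E) @ \oo --> inv_sq_kernel x y.
Proof.
rewrite /inv_sq_kernel /pois; case: eqVneq => [->|yx].
  apply/cvgeryP; apply/cvgryPge => A.
  near=> k.
  (* At [y = x] the kernel equals [k.+1%:R ^+ 2], which matches the value [+oo] of [inv_sq_kernel]
     there. *)
  rewrite subrr expr0n add0r exprVn invrK.
  rewrite (@le_trans _ _ (k%:R))//; first by near: k; exact: nbhs_infty_ger.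
  by rewrite -natrX ler_nat -mulnn (leq_trans (leqnSn k))// leq_pmulr.
apply: cvg_EFin; first by near=> k.
rewrite (_ : (x - y) ^- 2 = ((y - x) ^+ 2 + 0 ^+ 2)^-1); last first.
  by rewrite expr0n addr0 -sqrrN opprB.
apply: cvgV; first by rewrite expr0n addr0 sqrf_eq0 subr_eq0.
apply: cvgD; first exact: cvg_cst.
rewrite !expr2; under eq_fun do rewrite expr2.
by apply: cvgM; exact: cvg_harmonic.
Unshelve. all: by end_near. Qed.

Lemma pois_nondecreasing x y :
  {homo (fun k => (pois x k.+1%:R^-1 y)%:E) : k m / (k <= m)%N >-> (k <= m)%E}.
Proof.
move=> k m km; rewrite lee_fin /pois ler_pV2 ?inE ?unitfE.
- rewrite lerD2l lerXn2r ?nnegrE ?invr_ge0// lef_pV2 ?posrE//.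
  by rewrite ler_nat.
- by rewrite gt_eqF/= ltr_wpDl ?sqr_ge0// exprn_gt0// invr_gt0.
- by rewrite gt_eqF/= ltr_wpDl ?sqr_ge0// exprn_gt0// invr_gt0.
Qed.

(** Monotone convergence; the measurability hypothesis is later read off from the integrability in
    [assoc_measure]. *)
Lemma inv_sq_integral_cvg x (mu : {measure set R -> \bar R}) :
  (forall k, measurable_fun setT (fun y => (pois x k.+1%:R^-1 y)%:E)) ->
  (\int[mu]_y (pois x k.+1%:R^-1 y)%:E)%E @[k --> \oo] -->
  (\int[mu]_y inv_sq_kernel x y)%E.
Proof.
move=> mp.
have := @cvg_monotone_convergence _ _ R mu setT measurableT
  (fun k y => (pois x k.+1%:R^-1 y)%:E) mp.
rewrite (@eq_integral _ _ _ mu setT (inv_sq_kernel x)).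
  by apply=> [k y _|y _]; [rewrite lee_fin pois_ge0|exact: pois_nondecreasing].
by move=> y _; apply/cvg_lim => //; exact: cvg_pois.
Qed.

Lemma inv_sq_integral_ge x (mu : {measure set R -> \bar R}) k :
  (forall k, measurable_fun setT (fun y => (pois x k.+1%:R^-1 y)%:E)) ->
  (\int[mu]_y (pois x k.+1%:R^-1 y)%:E <= \int[mu]_y inv_sq_kernel x y)%E.
Proof.
move=> mp; have h := @inv_sq_integral_cvg x mu mp.
rewrite -(cvg_lim _ h)//; apply: lime_ge; first exact: cvgP h.
near=> m; apply: ge0_le_integral => //.
- by move=> y _; rewrite lee_fin pois_ge0.
- move=> y _; apply: pois_nondecreasing.
  by near: m; exact: nbhs_infty_ge.
Unshelve. all: by end_near. Qed.

Lemma hermitian_qform_im n (A : 'M[R[i]]_n) a : hermitian_mx A -> imC (qform A a) = 0.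
Proof.
move=> hA; have : imC (qform A a) = - imC (qform A a).
  by rewrite -imC_conj qform_ipn {1}ipn_hermitian// ipnC.
lra.
Qed.

(** The Hermitian constant has a real quadratic form and drops out, the real number [qform K a] is
    multiplied by [e], and the kernel has imaginary part [e * pois x e y]. *)
Lemma assoc_measure_im n (F : R[i] -> 'M[R[i]]_n) Om : assoc_measure F Om ->
  exists2 K : 'M[R[i]]_n, forall a, 0 <= reC (qform K a) &
    forall a mu, scalar_part Om a mu -> forall x e, 0 < e ->
    mu.-integrable setT (fun y => (pois x e y)%:E) /\
    imC (qform (F (x +i* e)%C) a) =
      e * (reC (qform K a) + fine (\int[mu]_y (pois x e y)%:E)%E).
Proof.
case=> _ [Cm [K [hC [hK K0] h]]]; exists K.
  by move=> a; have := K0 a; case: (qform K a) => p q; rewrite lecE => /andP[].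
move=> a mu amu x e e0.
have [|[_ im_int] qE] := h a mu amu (x +i* e)%C; first by rewrite gt_eqF.
have e_neq0 : e != 0 by rewrite gt_eqF.
have pE y : (pois x e y)%:E = (e^-1%:E * (imC (herglotz_kernel (x +i* e)%C y))%:E)%E.
  by rewrite herglotz_kernel_im -EFinM mulKf.
have pint : mu.-integrable setT (fun y => (pois x e y)%:E).
  by under eq_fun do rewrite pE; exact: integrableZl.
split => //; rewrite qE !reimE hermitian_qform_im// hermitian_qform_im// add0r.
rewrite mul0r addr0 mulrDr (mulrC e); congr (_ + _).
transitivity (fine (\int[mu]_y (imC (herglotz_kernel (x +i* e)%C y))%:E)%E) => //.
under eq_integral do rewrite herglotz_kernel_im EFinM.
by rewrite integralZl// fineM// integrable_fin_num.
Qed.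

End PoissonKernel.

(** * Finite sums and coordinates *)

Lemma lin_subspace_sum (R : realType) (H : lmodType R[i]) (L : set H) n
    (c : 'I_n -> R[i]) (v : 'I_n -> H) :
  lin_subspace L -> (forall i, L (v i)) -> L (\sum_i c i *: v i).
Proof.
move=> [L0 Llin] vL; elim/big_rec : _ => // i y _ Ly; exact: Llin.
Qed.

Lemma sum_scale_delta (K : fieldType) n (c : 'I_n -> K) :
  \sum_i c i *: delta_mx i 0 = \col_i c i :> 'cV[K]_n.
Proof.
apply/colP => j; rewrite summxE mxE (bigD1 j)//= big1 ?addr0.
  by rewrite !mxE !eqxx mulr1.
by move=> i ij; rewrite !mxE eq_sym (negPf ij) mulr0.
Qed.

Lemma ipn_delta (R : realType) n (A : 'M[R[i]]_n) i j :
  ipn (A *m delta_mx j 0) (delta_mx i 0) = A i j.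
Proof.
rewrite /ipn -colE (bigD1 i)//= big1 ?addr0.
  by rewrite !mxE !eqxx rmorph1 mulr1.
by move=> k ki; rewrite !mxE (negPf ki) rmorph0 mulr0.
Qed.

(** * Eigenvalues of maximal multiplicity *)

Section MaximalEigenvalues.
Variables (R : realType) (H : lmodType R[i]) (ip : H -> H -> R[i]).
Hypothesis HH : is_hilbert ip.
Let Hip : is_inner_product ip := HH.1.
Variables (DB : set H) (B : H -> H) (DBs : set H) (Bs : H -> H).
Hypothesis B_op : operator DB B.
Hypothesis B_dense : dense_dom ip DB.
Hypothesis B_closed : closed_op ip DB B.
Hypothesis B_sym : symmetric_op ip DB B.
Hypothesis B_cns : completely_nonselfadjoint ip DB B.
Hypothesis B_adj : adjoint_of ip DB B DBs Bs.
Variables (n : nat) (G1 G2 : H -> 'cV[R[i]]_n).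
Hypothesis triplet : boundary_triplet ip DBs Bs G1 G2.
(** The section is applied to the triplet with boundary maps [D' *m G1 f - G2 f] and [G1 f]; there
    [N z] is [invmx (D' - M z)] and [L] is [invmx (D' - D)]. *)
Variable N : R[i] -> 'M[R[i]]_n.
Hypothesis N_weyl : forall z, imC z != 0 ->
  forall f, kerz DBs Bs z f -> G2 f = N z *m G1 f.
Variable L : 'M[R[i]]_n.
Hypothesis L_herm : hermitian_mx L.
Variable Om : set R -> 'M[R[i]]_n.
Hypothesis N_Om : assoc_measure N Om.
Implicit Types (x e : R) (u : 'cV[R[i]]_n) (f g : H).

Let Bs_op : operator DBs Bs := adjoint_operator HH B_dense B_adj.
Let A1_sym := A1_symmetric triplet.

(** Green's formula for [g] with itself. Together with [assoc_measure_im] it expresses [sqn ip g] by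
    a Poisson integral. *)
Lemma weyl_im z g : imC z != 0 -> kerz DBs Bs z g ->
  imC (qform (N z) (G1 g)) = imC z * sqn ip g.
Proof.
move=> z0 gz; have [Dg Bg] := gz.
have := green triplet Dg Dg; rewrite Bg (N_weyl z0 gz) -qform_ipn.
rewrite (ipnC (N z *m _)) -qform_ipn (ipZl Hip) (ipZr Hip) (ipxx Hip).
move=> /(congr1 (@imC R)); rewrite !reimE; lra.
Qed.

Lemma A1_im0 w : DBs w -> G1 w = 0 -> imC (ip (Bs w) w) = 0.
Proof. by move=> Dw w1; apply: (symmetric_im0 HH A1_sym). Qed.

(** As [g - f] lies in the domain of [A_1], the imaginary part of [ip (Bs (g - f)) (g - f)]
    vanishes. This says that [g] and [g - f] have a cross term with zero real part, and Pythagoras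
    gives the bound. *)
Lemma gamma_le_eigenvector x e f g : e != 0 -> DBs f -> Bs f = toC x *: f ->
  kerz DBs Bs (x +i* e)%C g -> G1 g = G1 f -> sqn ip g <= sqn ip f.
Proof.
move=> e0 Df Bf [Dg Bg] gf.
have [[Dw Bw] [w1 _]] := (operatorB Bs_op Dg Df, GammaB triplet Dg Df).
have := A1_im0 Dw; rewrite w1 gf subrr => /(_ erefl).
have -> : Bs (g - f) = toC x *: (g - f) + (0 +i* e)%C *: g.
  rewrite Bw Bg Bf scalerBr addrAC -scalerDl; congr (_ *: _ - _).
  by apply: eqCP; rewrite !reimE /= ?addr0 ?add0r.
rewrite (ipDl Hip) (ipZl Hip) (ipZl Hip) (ipxx Hip) !reimE /= => im0.
have /eqP : e * reC (ip g (g - f)) = 0 by move: im0; lra.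
rewrite mulf_eq0 (negPf e0) /= => /eqP h.
have -> : f = g - (g - f) by rewrite opprB addrC subrK.
by rewrite (sqnB Hip g) h mulr0 subr0 lerDl sqn_ge0.
Qed.

(** Green's formula for [g] and [f], the factor being the difference of the two spectral parameters.
    It makes the entries of [N - L] of order [e]. *)
Lemma gamma_eigenvector x e f g : e != 0 ->
  DBs f -> Bs f = toC x *: f -> G2 f = L *m G1 f -> kerz DBs Bs (x +i* e)%C g ->
  ipn ((N (x +i* e)%C - L) *m G1 g) (G1 f) = (0 +i* e)%C * ip g f.
Proof.
move=> e0 Df Bf f2 gz; have [Dg Bg] := gz.
have := green triplet Dg Df; rewrite Bg Bf f2 (N_weyl _ gz)//.
rewrite mulmxBl ipnBl (ipn_hermitian _ _ L_herm) => <-.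
rewrite (ipZl Hip) (ipZr Hip) -mulrBl; congr (_ * _).
by apply: eqCP; rewrite !reimE /= ?subrr ?subr0 ?oppr0 ?opprK ?addr0.
Qed.

(* With A_1 symmetric, Re<(e g - d h), g - h> = 0, so that
   |g - h|^2 = (|h|^2 - |g|^2) (e - d) / (e + d). *)
Lemma gamma_dist x d e g h : 0 < d -> d < e -> kerz DBs Bs (x +i* e)%C g ->
  kerz DBs Bs (x +i* d)%C h -> G1 g = G1 h ->
  sqn ip (g - h) <= sqn ip h - sqn ip g.
Proof.
move=> d0 de [Dg Bg] [Dh Bh] gh.
have [[Dw Bw] [w1 _]] := (operatorB Bs_op Dg Dh, GammaB triplet Dg Dh).
have := A1_im0 Dw; rewrite w1 gh subrr => /(_ erefl).
have E : imC (ip (Bs (g - h)) (g - h)) =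
    e * sqn ip g + d * sqn ip h - (e + d) * reC (ip g h).
  rewrite Bw Bg Bh !(ipBl Hip, ipBr Hip) !(ipZl Hip) (ipC Hip g h) !(ipxx Hip).
  by rewrite !reimE /=; ring.
have := sqn_ge0 Hip (g - h); rewrite E (sqnB Hip).
move: (sqn ip g) (sqn ip h) (reC _) => a b c abc h0.
have ab : 0 <= b - a.
  have ed : 0 < e - d by rewrite subr_gt0.
  rewrite -(pmulr_rge0 _ ed).
  have -> : (e - d) * (b - a) = (e + d) * (a + b - 2 * c) by lra.
  by rewrite mulr_ge0// addr_ge0// ltW// (lt_trans d0).
have ed : 0 < e + d by rewrite addr_gt0// (lt_trans d0).
(* The goal [a + b - 2 * c <= b - a] amounts to [a <= c]. *)
have : 0 <= c - a.
  rewrite -(pmulr_rge0 _ ed) (_ : _ * _ = d * (b - a)); last by lra.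
  by rewrite mulr_ge0// ltW.
lra.
Qed.

(** * The eigenspace and its first boundary values *)

Let eigL x := kerz (ext_dom DBs G1 G2 L) Bs (toC x).

Lemma eigL_subspace x : lin_subspace (eigL x).
Proof.
have [[D0 Dlin] Blin] := Bs_op.
have [B0 [G10 G20]] := (operatorB Bs_op D0 D0, GammaB triplet D0 D0).
rewrite !subrr in B0 G10 G20.
split; first by split; [split; rewrite // G10 G20 mulmx0|rewrite B0.2 scaler0].
move=> a f g [[Df f2] Bf] [[Dg g2] Bg].
have [h1 h2] := Gamma_lin triplet a Df Dg.
split; first by split; [exact: Dlin|rewrite h1 h2 f2 g2 mulmxDr scalemxAr].
by rewrite Blin// Bf Bg scalerDr !scalerA mulrC.
Qed.

Lemma Gamma1_sum (c : 'I_n -> R[i]) (v : 'I_n -> H) : (forall i, DBs (v i)) ->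
  G1 (\sum_i c i *: v i) = \sum_i c i *: G1 (v i).
Proof.
have [[D0 Dlin] Blin] := Bs_op.
have [G10 _] := GammaB triplet D0 D0; rewrite !subrr in G10.
move=> Dv; suff [] : DBs (\sum_i c i *: v i) /\
  G1 (\sum_i c i *: v i) = \sum_i c i *: G1 (v i) by [].
elim/big_rec2 : _ => // i y z _ [Dz zE]; split; first exact: Dlin.
by have [-> _] := Gamma_lin triplet (c i) (Dv i) Dz; rewrite zE.
Qed.

(** If [G1 f = 0] then [G2 f = L *m G1 f] vanishes too, and [no_eigenvector] applies. *)
Lemma eigL_Gamma1_inj x f : eigL x f -> G1 f = 0 -> f = 0.
Proof.
move=> [[Df f2] Bf] f1; rewrite f1 mulmx0 in f2.
exact: (no_eigenvector HH B_op B_dense B_closed B_sym B_adj triplet B_cns Df f1 f2 Bf).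
Qed.

Lemma eigL_onto_has_dim x : (forall u, exists2 f, eigL x f & G1 f = u) ->
  has_dim (eigL x) n.
Proof.
move=> onto.
have [v vP] := choice_exists2 (fun i : 'I_n => onto (delta_mx i 0)).
have vE i : eigL x (v i) by case: (vP i).
have G1v c : G1 (\sum_i c i *: v i) = \col_i c i.
  rewrite Gamma1_sum; last by move=> i; case: (vE i) => -[].
  rewrite -sum_scale_delta; apply: eq_bigr => i _.
  by have [_ ->] := vP i.
exists v; split => // [c c0 i|f Ef].
  have := G1v c; rewrite c0 => /colP/(_ i).
  have [[D0 _] _] := Bs_op.
  have [G10 _] := GammaB triplet D0 D0; rewrite !subrr in G10.
  by rewrite G10 !mxE.
exists (fun i => G1 f i 0); apply/eqP; rewrite -subr_eq0; apply/eqP.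
have Es := lin_subspace_sum (fun i => G1 f i 0) (eigL_subspace x) vE.
apply: (eigL_Gamma1_inj (x := x)).
  rewrite addrC -scaleN1r; have [_ lin] := eigL_subspace x; exact: lin.
case: Ef Es => [[Df _] _] [[Ds _] _].
have [-> _] := GammaB triplet Df Ds; rewrite G1v.
by apply/colP => i; rewrite !mxE subrr.
Qed.

(** The first boundary values of a basis are the columns of a square matrix [V], invertible because
    [G1] is injective on the eigenspace. *)
Lemma has_dim_eigL_onto x : has_dim (eigL x) n ->
  forall u, exists2 f, eigL x f & G1 f = u.
Proof.
move=> [v [vE vfree _]] u.
pose V := \matrix_(i, j) G1 (v j) i 0.
have G1v (c : 'cV[R[i]]_n) : G1 (\sum_i c i 0 *: v i) = V *m c.
  rewrite Gamma1_sum; last by move=> i; case: (vE i) => -[].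
  apply/colP => i; rewrite summxE mxE; apply: eq_bigr => j _.
  by rewrite !mxE mulrC.
have Vu : V \in unitmx.
  rewrite -unitmx_tr -row_free_unit; apply: inj_row_free => r rV.
  have r0 : V *m r^T = 0 by apply: trmx_inj; rewrite trmx_mul trmxK rV trmx0.
  have : \sum_i r^T i 0 *: v i = 0.
    apply: (eigL_Gamma1_inj (x := x)); last by rewrite G1v.
    by apply: lin_subspace_sum => //; exact: eigL_subspace.
  move=> /vfree h; apply/rowP => i; have := h i.
  by rewrite !mxE.
exists (\sum_i (invmx V *m u) i 0 *: v i); last by rewrite G1v mulKVmx.
by apply: lin_subspace_sum => //; exact: eigL_subspace.
Qed.

(** An eigenvector [f] with boundary value [a] bounds all Poisson integrals by [sqn ip f], the
    nonnegative term from [K] being dropped; the bound survives the monotone limit. *)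
Lemma eigL_onto_finite x : (forall u, exists2 f, eigL x f & G1 f = u) ->
  finite_inv_sq_integral Om x.
Proof.
move=> onto a mu amu; have [f [[Df f2] Bf] f1] := onto a.
have [K K0 h] := assoc_measure_im N_Om.
have ek k : (0 : R) < k.+1%:R^-1 by rewrite invr_gt0.
have mp k : measurable_fun setT (fun y => (pois x k.+1%:R^-1 y)%:E).
  by have [/measurable_int] := h a mu amu x _ (ek k).
apply: (@le_lt_trans _ _ (sqn ip f)%:E); last exact: ltry.
have hc := @inv_sq_integral_cvg R x mu mp.
rewrite -(cvg_lim _ hc)//; apply: lime_le; first exact: cvgP hc.
apply: nearW => k; have [pint] := h a mu amu x _ (ek k).
have k0 : imC (x +i* (k.+1%:R^-1 : R))%C != 0 by rewrite /= gt_eqF ?ek.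
have [g gz g1] := gamma_exists HH B_dense B_sym B_adj triplet a k0.
rewrite -{1}g1 weyl_im// => /(mulfI k0) gE.
rewrite -[X in (X <= _)%E]fineK ?integrable_fin_num// lee_fin.
have := gamma_le_eigenvector k0 Df Bf gz; rewrite g1 f1 => /(_ erefl).
by have := K0 a; move: gE; lra.
Qed.

Lemma eigL_onto_boundary x : (forall u, exists2 f, eigL x f & G1 f = u) ->
  boundary_value N x L.
Proof.
move=> onto _ /ltC0P[r r0 ->].
have [v vP] := choice_exists2 (fun i : 'I_n => onto (delta_mx i 0)).
(* A common bound for the squared norms of the eigenvectors over the standard basis, made positive
   by the added 1. Each entry of [N - L] then has modulus at most [e * S]. *)
pose S := \sum_i sqn ip (v i) + 1.
have vS i : sqn ip (v i) <= S.
  rewrite /S (bigD1 i)//= -addrA lerDl addr_ge0//.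
  by apply: sumr_ge0 => j _; exact: sqn_ge0.
have S0 : 0 < S by rewrite ltr_wpDl// sumr_ge0// => j _; exact: sqn_ge0.
exists (r / S); first by rewrite divr_gt0.
move=> e /andP[e0]; rewrite ltr_pdivlMr// => eS i j.
rewrite normC_lt//.
have [[[[Di i2] Bi] i1] [[[Dj _] Bj] j1]] := (vP i, vP j).
have ez : imC (x +i* e)%C != 0 by rewrite gt_eqF.
have [g gz g1] := gamma_exists HH B_dense B_sym B_adj triplet (delta_mx j 0) ez.
have -> : N (x +i* e)%C i j - L i j = (N (x +i* e)%C - L) i j by rewrite !mxE.
rewrite -ipn_delta -g1 -i1 gamma_eigenvector// sqCM.
have gj : sqn ip g <= S.
  by apply: le_trans (vS j); apply: (gamma_le_eigenvector ez Dj Bj gz); rewrite g1.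
rewrite (@le_lt_trans _ _ ((e * S) ^+ 2))//; last first.
  by rewrite ltrXn2r// ?mulr_ge0// ltW.
rewrite exprMn /sqC /= expr0n add0r ler_wpM2l ?sqr_ge0//.
apply: le_trans (cauchy_schwarz Hip _ _) _; rewrite expr2.
by rewrite ler_pM ?sqn_ge0.
Qed.

Lemma cvgC_natSinv x : cvgC (fun k => (x +i* k.+1%:R^-1)%C) (toC x).
Proof.
move=> _ /ltC0P[r r0 ->]; have [m Hm] := natSinv_lt r0.
exists m => k /Hm kr; rewrite normC_lt// /sqC !reimE /= subrr expr0n add0r subr0.
by rewrite ltrXn2r// ?invr_ge0// ltW.
Qed.

(** By [gamma_dist] the squared norms increase, and their increments dominate the squared distances;
    a bounded sequence is therefore Cauchy. *)
Lemma gamma_seq_cvg x (g : nat -> H) (C : R) :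
  (forall k, kerz DBs Bs (x +i* k.+1%:R^-1)%C (g k)) ->
  (forall k m, G1 (g k) = G1 (g m)) -> (forall k, sqn ip (g k) <= C) ->
  exists f, hcvg ip g f.
Proof.
move=> gz g1 gC; apply: HH.2; apply: hcauchyP => // e e0.
pose S := [set sqn ip (g k) | k in setT]%classic.
have Ssup : has_sup S.
  split; first by exists (sqn ip (g 0%N)), 0%N.
  by exists C => _ [k _ <-].
(* From the index [m] on, the squared norms are within [e] of their supremum. *)
have [_ [m _ <-] hm] := sup_adherent e0 Ssup.
have dist k l : (k < l)%N -> sqn ip (g k - g l) <= sqn ip (g l) - sqn ip (g k).
  move=> kl; apply: (gamma_dist _ _ (gz k) (gz l) (g1 k l)).
    by rewrite invr_gt0.
  by rewrite ltf_pV2 ?posrE// ltr_nat.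
have mono k l : (k <= l)%N -> sqn ip (g k) <= sqn ip (g l).
  rewrite leq_eqVlt => /predU1P[-> //|/dist h].
  by rewrite -subr_ge0 (le_trans _ h)// sqn_ge0.
have small k l : (m <= k)%N -> (k < l)%N -> sqn ip (g k - g l) < e.
  move=> mk /dist h.
  have : sqn ip (g l) <= sup S by apply: ub_le_sup; [case: Ssup|exists l].
  by have := mono _ _ mk; lra.
exists m => k l mk ml; have [kl|lk|<-] := ltngtP k l.
- exact: small.
- by rewrite sqnBC//; exact: small.
- by rewrite subrr /sqn (ip0l Hip).
Qed.

(** The eigenvector is the limit of the [g k] with boundary value [u] at [x + i / (k + 1)]. The
    singular integral bounds their norms, and the boundary value of [N] supplies [G2] of the
    limit. *)
Lemma boundary_eigL_onto x : finite_inv_sq_integral Om x ->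
  boundary_value N x L -> forall u, exists2 f, eigL x f & G1 f = u.
Proof.
move=> fin bv u.
have ek k : (0 : R) < k.+1%:R^-1 by rewrite invr_gt0.
have k0 k : imC (x +i* (k.+1%:R^-1 : R))%C != 0 by rewrite /= gt_eqF ?ek.
have [g gP] := choice_exists2 (fun k =>
  gamma_exists HH B_dense B_sym B_adj triplet u (k0 k)).
have gz k : kerz DBs Bs (x +i* k.+1%:R^-1)%C (g k) by case: (gP k).
have g1 k : G1 (g k) = u by case: (gP k).
have [[_ _ /(_ u) [mu umu]] _] := N_Om.
have [K K0 h] := assoc_measure_im N_Om.
have mp k : measurable_fun setT (fun y => (pois x k.+1%:R^-1 y)%:E).
  by have [/measurable_int] := h u mu umu x _ (ek k).
have fint : (\int[mu]_y inv_sq_kernel x y)%E \is a fin_num.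
  rewrite ge0_fin_numE; first exact: fin umu.
  apply: integral_ge0 => y _.
  rewrite /inv_sq_kernel; case: ifP => // _.
  by rewrite lee_fin invr_ge0 sqr_ge0.
have [f gf] : exists f, hcvg ip g f.
  apply: (gamma_seq_cvg (C := reC (qform K u) +
    fine (\int[mu]_y inv_sq_kernel x y)%E) gz) => k; first by move=> l; rewrite !g1.
  have [pint] := h u mu umu x _ (ek k).
  rewrite -{1}(g1 k) weyl_im// => /(mulfI (k0 k)) ->.
  rewrite lerD2l fine_le//; first exact: integrable_fin_num.
  exact: inv_sq_integral_ge.
have zip y : cvgC (fun k => ip (Bs (g k)) y) (ip (toC x *: f) y).
  rewrite (ipZl Hip) (_ : (fun k => _) =
    fun k => (x +i* k.+1%:R^-1)%C * ip (g k) y).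
    by apply: cvgCM; [exact: cvgC_natSinv|exact: hcvg_ip].
  by apply/funext => k; have [_ ->] := gz k; rewrite (ipZl Hip).
(* The eigenvalue equation has passed to the limit weakly, and testing against [DB] is enough for
   the adjoint. *)
have [|Df Bf] := @adjoint_intro _ _ ip HH DB B DBs Bs B_dense B_adj f (toC x *: f).
  move=> d Dd; rewrite (ipC Hip f) (ipC Hip (toC x *: f)); congr (_^*)%R.
  apply: (@cvgC_unique _ (fun k => ip (g k) (B d))); first exact: hcvg_ip.
  rewrite (_ : (fun k => _) = fun k => ip (Bs (g k)) d); first exact: zip.
  apply/funext => k; have [Dg _] := gz k.
  by rewrite (ipC Hip (B d)) (B_adj.2 _ _ Dg Dd) -(ipC Hip).
have [f1 f2] : G1 f = u /\ G2 f = L *m u; last first.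
  by exists f => //; split => //; split => //; rewrite f1.
(* Both sides of Green's formula for [g k] and [y] converge. Equating the limits identifies both
   boundary values of [f] without any continuity of [G1] and [G2]. *)
apply: (boundary_values_unique triplet Df) => y Dy; rewrite Bf.
apply: (@cvgC_unique _ (fun k => ip (Bs (g k)) y - ip (g k) (Bs y))).
  by apply: cvgCB => //; exact: hcvg_ip.
rewrite (_ : (fun k => _) = fun k =>
    ipn (N (x +i* k.+1%:R^-1)%C *m u) (G1 y) - ipn u (G2 y)); last first.
  apply/funext => k; have [Dg _] := gz k.
  by rewrite (green triplet)// (N_weyl (k0 k) (gz k)) g1.
apply: cvgCB; last exact: cvgC_cst.
apply: (cvgC_sum (u := fun k i => (N (x +i* k.+1%:R^-1)%C *m u) i 0 * (G1 y i 0)^*)).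
move=> i; apply: cvgCM; last exact: cvgC_cst.
rewrite mxE (_ : (fun k => _) = fun k => \sum_j N (x +i* k.+1%:R^-1)%C i j * u j 0).
  apply: (cvgC_sum (u := fun k j => N (x +i* k.+1%:R^-1)%C i j * u j 0)) => j.
  apply: cvgCM; last exact: cvgC_cst.
  move=> r r0; have [d d0 hd] := bv r r0; have [m Hm] := natSinv_lt d0.
  by exists m => k /Hm kd; apply: hd; rewrite ek.
by apply/funext => k; rewrite mxE.
Qed.

Lemma sigma_p_max_boundary (z : R[i]) : (0 < n)%N ->
  sigma_p_max (ext_dom DBs G1 G2 L) Bs n z <->
  exists x : R, [/\ z = (x +i* 0)%C, finite_inv_sq_integral Om x &
    boundary_value N x L].
Proof.
move=> n0; split=> [[[f [Ef Bf] f0] hd]|[x [-> fin bv]]].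
  have z0 : imC z = 0.
    apply/eqP/negPn/negP => z0; apply: f0.
    apply: (symmetric_injective HH (ext_symmetric triplet L_herm) z0 Ef).
    by rewrite Bf subrr.
  have zE : z = toC (reC z) by apply: eqCP; rewrite !reimE.
  rewrite zE in hd; have onto := has_dim_eigL_onto hd.
  exists (reC z); split => //; first exact: eigL_onto_finite.
  exact: eigL_onto_boundary.
have onto := boundary_eigL_onto fin bv.
split; last exact: eigL_onto_has_dim.
(* As [n] is positive there is a nonzero boundary value, and an eigenvector over it cannot be 0. *)
have [f Ef f1] := onto (delta_mx (Ordinal n0) 0); exists f => // f0.
have [[D0 _] _] := Bs_op; have [G10 _] := GammaB triplet D0 D0.
move: f1; rewrite f0 -{1}(subrr 0) G10 subrr => /colP/(_ (Ordinal n0)).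
by rewrite !mxE !eqxx => /esym/eqP; rewrite oner_eq0.
Qed.

End MaximalEigenvalues.

(** * Hermitian matrices and the change of triplet *)

Lemma hermitian_mxE (R : realType) n (A : 'M[R[i]]_n) :
  hermitian_mx A <-> A^T = map_mx Num.conj A.
Proof.
split=> [h|h i j]; first by apply/matrixP => i j; rewrite !mxE h.
by move/matrixP: h => /(_ i j); rewrite !mxE.
Qed.

Lemma hermitian_mxB (R : realType) n (A B : 'M[R[i]]_n) :
  hermitian_mx A -> hermitian_mx B -> hermitian_mx (A - B).
Proof. by move=> hA hB i j; rewrite !mxE hA hB rmorphB. Qed.

Lemma hermitian_invmx (R : realType) n (A : 'M[R[i]]_n) :
  hermitian_mx A -> hermitian_mx (invmx A).
Proof. by rewrite !hermitian_mxE trmx_inv map_invmx => ->. Qed.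

(** In Green's formula the two terms with [E] cancel because [E] is Hermitian; the change of
    boundary maps is invertible, which preserves surjectivity. *)
Lemma boundary_triplet_transform (R : realType) (H : lmodType R[i])
    (ip : H -> H -> R[i]) n DBs Bs (G1 G2 : H -> 'cV[R[i]]_n) (E : 'M[R[i]]_n) :
  hermitian_mx E -> boundary_triplet ip DBs Bs G1 G2 ->
  boundary_triplet ip DBs Bs (fun f => E *m G1 f - G2 f) G1.
Proof.
move=> hE [h1 h2 h3 h4]; split => //.
- move=> a x y Dx Dy; rewrite h1// h2// mulmxDr -scalemxAr scalerBr opprD.
  by rewrite addrACA.
- move=> x y Dx Dy; rewrite h3// ipnBl ipnBr (ipn_hermitian _ _ hE); ring.
- move=> u v; have [f [Df f1 f2]] := h4 v (E *m v - u); exists f; split => //.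
  by rewrite f1 f2 opprB addrC subrK.
Qed.

Theorem theorem6p1 (R : realType) (H : lmodType R[i]) (ip : H -> H -> R[i])
  (n : nat) (DB : set H) (B : H -> H) (DBs : set H) (Bs : H -> H)
  (G1 G2 : H -> 'cV[R[i]]_n) (M : R[i] -> 'M[R[i]]_n)
  (D D' : 'M[R[i]]_n) (Om : set R -> 'M[R[i]]_n) :
  is_hilbert ip -> (0 < n)%N ->
  operator DB B -> dense_dom ip DB -> closed_op ip DB B -> symmetric_op ip DB B ->
  completely_nonselfadjoint ip DB B ->
  adjoint_of ip DB B DBs Bs ->
  deficiency_indices DBs Bs n ->
  boundary_triplet ip DBs Bs G1 G2 ->
  weyl_function ip DBs Bs G1 G2 M ->
  hermitian_mx D -> hermitian_mx D' -> \det (D - D') != 0 ->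
  assoc_measure (fun z => invmx (D' - M z)) Om ->
  forall z : R[i],
    sigma_p_max (ext_dom DBs G1 G2 D) Bs n z <->
    exists x : R, [/\ z = (x +i* 0)%C, finite_inv_sq_integral Om x &
      boundary_value (fun w => invmx (D' - M w)) x (invmx (D' - D))].
Proof.
move=> HH n0 B_op B_dense B_closed B_sym B_cns B_adj _ tri weyl hD hD' det N_Om z.
have tri' := boundary_triplet_transform hD' tri.
have DDu : D' - D \in unitmx.
  by rewrite -opprB -scaleN1r unitmxZ ?unitrN1// unitmxE unitfE.
have G1'E w f : imC w != 0 -> kerz DBs Bs w f ->
    D' *m G1 f - G2 f = (D' - M w) *m G1 f.
  move=> w0 fw; rewrite (weyl w (A1_resolvent HH B_dense B_sym B_adj tri w0) f fw).
  by rewrite mulmxBl.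
(* A right inverse of [D' - M w] has as columns the values [G1 (g j)], where [g j] in the kernel of
   [Bs - w] has the [j]-th basis vector as its new first boundary value. *)
have DMu w : imC w != 0 -> D' - M w \in unitmx.
  move=> w0.
  have [g gP] := choice_exists2 (fun j : 'I_n =>
    gamma_exists HH B_dense B_sym B_adj tri' (delta_mx j 0) w0).
  suff /mulmx1_unit[] : (D' - M w) *m (\matrix_(i, j) G1 (g j) i 0) = 1%:M by [].
  apply/matrixP => i j; have [gw] := gP j.
  rewrite (G1'E w)// => /colP/(_ i); rewrite !mxE eqxx andbT => <-.
  by apply: eq_bigr => k _; rewrite !mxE.
(* [G2 f = D *m G1 f] is the same as [(D' - D) *m G1 f = D' *m G1 f - G2 f], and [D' - D] is
   invertible. *)
have -> : ext_dom DBs G1 G2 D =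
    ext_dom DBs (fun f => D' *m G1 f - G2 f) G1 (invmx (D' - D)).
  apply/funext => f; apply/propext; split=> -[Df f2]; split => //.
    by rewrite f2 -mulmxBl mulKmx.
  have := congr1 (mulmx (D' - D)) f2; rewrite mulKVmx// mulmxBl.
  by move/addrI/oppr_inj.
apply: (sigma_p_max_boundary HH B_op B_dense B_closed B_sym B_cns B_adj tri' _ _ N_Om z n0).
  by move=> w w0 f fw /=; rewrite (G1'E w)// mulKmx// DMu.
exact/hermitian_invmx/hermitian_mxB.
Qed.
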